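(* For any finite forest $F$ and any field $\mathbb{F}$, \[c_2(F)=\mathrm{mr}(F,\mathbb{F})=|F|-p(F).\]
   Context: All graphs are finite and simple; $|F|$ denotes the number of vertices of $F$. A subgraph complementation system for a graph $G=(V,E)$ is a finite collection (family) $\mathscr{C}$ of subsets of $V$ such that, for any two distinct vertices $u,v\in V$, $uv\in E$ if and only if $u$ and $v$ appear together in an odd number of sets in $\mathscr{C}$. The subgraph complementation number $c_2(G)$ is the minimum cardinality of a subgraph complementation system for $G$. A symmetric matrix over a field $\mathbb{F}$ with rows and columns indexed by $V$ fits $G$ if, for distinct $u,v$, its $(u,v)$ entry is nonzero if and only if $uv\in E$ (the diagonal is arbitrary). $\mathrm{mr}(G,\mathbb{F})$ is the minimum rank over $\mathbb{F}$ of a symmetric matrix over $\mathbb{F}$ which fits $G$. The path cover number $p(G)$ is the minimum cardinality of a collection of vertex-disjoint induced paths of $G$ (a single vertex counts as a path) which cover all of the vertices of $G$. *)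

(* Defs.v *)
From mathcomp Require Import all_boot all_algebra.
From mathcomp Require Import boolp.

Set Implicit Arguments.
Unset Strict Implicit.
Unset Printing Implicit Defensive.

Record sgraph := SGraph {
  vertex :> finType;
  adj : rel vertex;
  adj_sym : symmetric adj;
  adj_irrefl : irreflexive adj }.

Definition forest (G : sgraph) : Prop :=
  forall s : seq G, 2 < size s -> ~ ucycle (@adj G) s.

Definition minimum (P : nat -> Prop) (exP : exists n, P n) : nat :=
  ex_minn (P := fun n => `[< P n >])
          (let: ex_intro n Pn := exP in ex_intro _ n (asboolT Pn)).

Lemma minimumP (P : nat -> Prop) (exP : exists n, P n) :
  P (minimum exP) /\ forall n, P n -> minimum exP <= n.
Proof.
rewrite /minimum; case: ex_minnP => m /asboolP Pm le_m.
by split=> // n Pn; apply/le_m/asboolP.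
Qed.

(* The family is a sequence of sets, so that repetitions are allowed and
   counted in its cardinality. *)
Definition complementation_system (G : sgraph) (C : seq {set G}) : Prop :=
  forall u v : G, u != v ->
    adj u v = odd (count (fun S : {set G} => (u \in S) && (v \in S)) C).

Lemma complementation_system_exists (G : sgraph) :
  exists k, exists2 C : seq {set G}, complementation_system C & size C = k.
Proof.
pose E := [set S : {set G} | [exists u, exists v, adj u v && (S == [set u; v])]].
exists (size (enum E)), (enum E) => // u v uDv.
have key S : S \in E -> (u \in S) && (v \in S) = (S == [set u; v]).
  rewrite inE => /existsP[a /existsP[b /andP[_ /eqP->]]].
  apply/idP/eqP => [|->]; last by rewrite !inE !eqxx orbT.
  rewrite !inE => /andP[/orP[]/eqP ua /orP[]/eqP vb]; subst=> //.
  - by rewrite eqxx in uDv.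
  - by rewrite setUC.
  - by rewrite eqxx in uDv.
have -> : count (fun S : {set G} => (u \in S) && (v \in S)) (enum E)
        = count_mem [set u; v] (enum E).
  by apply: eq_in_count => S; rewrite mem_enum => /key.
rewrite count_uniq_mem ?enum_uniq // mem_enum oddb inE.
apply/idP/existsP => [uv|[a /existsP[b /andP[ab /eqP eS]]]].
  by exists u; apply/existsP; exists v; rewrite uv eqxx.
have : u \in [set a; b] by rewrite -eS !inE eqxx.
have : v \in [set a; b] by rewrite -eS !inE eqxx orbT.
rewrite !inE => /orP[]/eqP va /orP[]/eqP ub; subst => //.
- by rewrite eqxx in uDv.
- by rewrite adj_sym.
- by rewrite eqxx in uDv.
Qed.

Definition complementation_number (G : sgraph) : nat :=
  minimum (complementation_system_exists G).

Definition fits (G : sgraph) (K : fieldType) (A : 'M[K]_#|G|) : Prop :=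
  A^T%R = A /\
  forall u v : G, u != v ->
    (A (enum_rank u) (enum_rank v) != 0%R) = adj u v.

Lemma fits_exists (G : sgraph) (K : fieldType) :
  exists r, exists2 A : 'M[K]_#|G|, fits A & \rank A = r.
Proof.
pose A : 'M[K]_#|G| :=
  (\matrix_(i, j) (adj (enum_val i) (enum_val j) : nat)%:R)%R.
exists (\rank A), A => //; split=> [|u v _].
  by apply/matrixP=> i j; rewrite !mxE adj_sym.
by rewrite mxE !enum_rankK; case: adj; rewrite ?GRing.oner_eq0 ?eqxx.
Qed.

Definition minimum_rank (G : sgraph) (K : fieldType) : nat :=
  minimum (fits_exists G K).

Definition induces_path (G : sgraph) (A : {set G}) : Prop :=
  exists s : seq G,
    [/\ s != [::], uniq s, A =i s &
        {in s &, forall u v, adj u v = (index v s == (index u s).+1)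
                                    || (index u s == (index v s).+1)}].

(* An induced path is determined by its vertex set, so a collection of
   disjoint induced paths covering G is a partition of G. *)
Definition path_cover (G : sgraph) (P : {set {set G}}) : Prop :=
  partition P [set: G] /\ {in P, forall A, induces_path A}.

Lemma singleton_path_cover (G : sgraph) :
  path_cover [set [set x] | x : G].
Proof.
split=> [|_ /imsetP[x _ ->]]; last first.
  exists [:: x]; split=> // [y|u v]; first by rewrite !inE.
  by rewrite !inE => /eqP-> /eqP->; rewrite adj_irrefl /= eqxx.
apply/and3P; split.
- apply/eqP/setP => x; rewrite inE; apply/bigcupP.
  by exists [set x]; rewrite ?imset_f ?inE.
- apply/trivIsetP=> _ _ /imsetP[x _ ->] /imsetP[y _ ->] xy.
  rewrite disjoints1 inE; apply: contraNneq xy => <-; exact: eqxx.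
- by apply/imsetP=> -[x _ /setP/(_ x)]; rewrite !inE eqxx.
Qed.

Lemma path_cover_exists (G : sgraph) :
  exists k, exists2 P : {set {set G}}, path_cover P & #|P| = k.
Proof.
by exists #|[set [set x] | x : G]|, [set [set x] | x : G];
  first exact: singleton_path_cover.
Qed.

Definition path_cover_number (G : sgraph) : nat :=
  minimum (path_cover_exists G).

(* The natural-number subtraction [#|G| - path_cover_number G] is therefore
   never truncated. *)
Lemma path_cover_number_le (G : sgraph) : path_cover_number G <= #|G|.
Proof.
have [_ le_p] := minimumP (path_cover_exists G).
apply: leq_trans (le_p _ (ex_intro2 _ _ _ (singleton_path_cover G) erefl)) _.
by rewrite card_imset //; exact: set1_inj.
Qed.

(* Main.v *)
Require Import Defs.
From mathcomp Require Import all_boot all_algebra zify.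

(* A path cover by p paths uses n - p edges, and these edges form a subgraph in
   which every degree is at most 2.

   Lower bound: let x be a leaf of F with neighbour y, and let A fit F.  If the
   diagonal entry a_xx is nonzero, pivoting on it lowers the rank and leaves a
   matrix fitting F - x; at most one path edge is lost.  Otherwise pivoting on
   a_yx and then on a_xy lowers the rank by 2 and leaves a matrix fitting
   F - x - y; at most two path edges are lost, namely those at y.  Hence
   rank A >= n - p for every A and every path cover.  A complementation system
   is a factorization over GF(2) of a matrix fitting F, so it obeys the same
   bound.

   Upper bound: an end x of a longest path, with neighbour y, satisfies one of
   the following.  Either y has at most one other neighbour, so that y ends its
   path in any cover of F - x, and x is appended to that path at the cost of one
   rank-1 matrix, or one set, for the edge xy; or y has a second leaf z, and the
   new path x y z comes with a rank-2 matrix, or two sets, covering the whole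
   star of y. *)

Set Implicit Arguments.
Unset Strict Implicit.
Unset Printing Implicit Defensive.
Import GRing.Theory.

(** * Ranks of matrices indexed by a finite type *)

Section FunctionMatrix.
Variables (T : finType) (K : fieldType).
Implicit Types f g : T -> T -> K.
Local Open Scope ring_scope.

Definition fun_mx f : 'M[K]_#|T| := \matrix_(i, j) f (enum_val i) (enum_val j).

Lemma fun_mx_add f g :
  fun_mx (fun u v => f u v + g u v) = fun_mx f + fun_mx g.
Proof. by apply/matrixP => i j; rewrite !mxE. Qed.

Lemma rank_outer_product (a b : T -> K) :
  (\rank (fun_mx (fun u v => a u * b v)%R) <= 1)%N.
Proof.
have -> : fun_mx (fun u v => a u * b v) =
    (\col_i a (enum_val i)) *m (\row_j b (enum_val j)).
  by apply/matrixP => i j; rewrite !mxE big_ord1 !mxE.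
exact: mulmx_max_rank.
Qed.

Lemma rank_fun_mx_add f g r s :
  (\rank (fun_mx f) <= r)%N -> (\rank (fun_mx g) <= s)%N ->
  (\rank (fun_mx (fun u v => f u v + g u v)%R) <= r + s)%N.
Proof.
move=> fr gs; rewrite fun_mx_add.
exact: leq_trans (mxrank_add _ _) (leq_add fr gs).
Qed.

(** Row operations keep the row space inside that of [f]; the inclusion is strict because column [y]
    is cleared while row [x] of [f] is nonzero there. *)
Lemma rank_pivot f x y : f x y != 0 ->
  (\rank (fun_mx (fun u v => f u v - f u y / f x y * f x v)%R) < \rank (fun_mx f))%N.
Proof.
move=> fxy; set g := fun u v => _.
have gy u : g u y = 0 by rewrite /g divfK ?subrr.
apply: rank_ltmx; rewrite ltmxE; apply/andP; split.
  have -> : fun_mx g = fun_mx f -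
      (\col_i (f (enum_val i) y / f x y)) *m row (enum_rank x) (fun_mx f).
    by apply/matrixP => i j; rewrite !mxE big_ord1 !mxE enum_rankK.
  rewrite addmx_sub ?eqmx_opp //.
  exact: submx_trans (submxMl _ _) (row_sub _ _).
apply/negP => /submxP[D defD]; move/eqP: fxy; apply.
have /matrixP/(_ (enum_rank x) (enum_rank y)) := defD.
rewrite !mxE !enum_rankK => ->; apply: big1 => i _.
by rewrite !mxE enum_rankK gy mulr0.
Qed.

End FunctionMatrix.

(** * Set systems and matrices built in parallel *)

Section Representable.
Variable T : finType.
Implicit Types e : rel T.

(** Pairing a set system with matrices over all fields lets one induction give both upper bounds. A
    relation on a fixed [T] stands for the graph, so that deleting a vertex merely isolates it. *)
Definition representable e k : Prop :=
  (exists2 C : seq {set T},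
     (forall u v, u != v ->
        e u v = odd (count (fun S : {set T} => (u \in S) && (v \in S)) C)) &
     size C = k)
  /\ forall K : fieldType, exists f : T -> T -> K,
     [/\ forall u v, f u v = f v u,
         forall u v, u != v -> (f u v != 0%R) = e u v &
         \rank (fun_mx f) <= k].

Lemma representable0 e : (forall u v, u != v -> ~~ e u v) -> representable e 0.
Proof.
move=> e0; split; first by exists [::] => // u v /e0/negbTE.
move=> K; exists (fun _ _ => 0%R); split=> // [u v /e0/negbTE->|].
  by rewrite eqxx.
have -> : fun_mx (fun _ _ : T => 0%R : K) = 0%R.
  by apply/matrixP => i j; rewrite !mxE.
by rewrite mxrank0.
Qed.

(** The set [[set x; y]], or the outer square of its indicator, affects only the pair [x], [y] off
    the diagonal, and the diagonal is free. *)
Lemma representable_leaf e e' x y k : symmetric e -> x != y ->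
  (forall v, e x v = (v == y)) ->
  (forall u v, e' u v = [&& u != x, v != x & e u v]) ->
  representable e' k -> representable e k.+1.
Proof.
move=> esym xy ex e'E [[C Cp <-] HK].
have yy u v : u != v -> (u == y) && (v == y) = false.
  by move=> uv; apply: contraNF uv => /andP[/eqP-> /eqP->].
split.
  exists ([set x; y] :: C) => // u v uv; rewrite /= oddD oddb -Cp // e'E !inE.
  case: (eqVneq u x) => [ux|ux]; case: (eqVneq v x) => [vx|vx] /=.
  - by rewrite ux vx eqxx in uv.
  - by rewrite addbF ux ex.
  - by rewrite addbF andbT vx esym ex.
  - by rewrite yy.
move=> K; have [f [fsym fe fr]] := HK K.
pose a u : K := ((u == x) || (u == y))%:R%R.
exists (fun u v => a u * a v + f u v)%R; split.
- by move=> u v; rewrite mulrC fsym.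
- move=> u v uv; case: (boolP (e' u v)) => [e'uv|e'uv]; last first.
    have -> : f u v = 0%R by apply/eqP; rewrite -[_ == _]negbK fe.
    move: e'uv; rewrite e'E addr0 /a.
    case: (eqVneq u x) => [ux|ux]; case: (eqVneq v x) => [vx|vx] //=.
    + by rewrite ux vx eqxx in uv.
    + by rewrite mul1r ux ex; case: (v == y); rewrite ?oner_eq0 ?eqxx.
    + by rewrite mulr1 vx esym ex; case: (u == y); rewrite ?oner_eq0 ?eqxx.
    + by move/negbTE->; apply/negbTE; rewrite negbK -natrM mulnb yy.
  have := e'uv; rewrite e'E => /and3P[ux vx ->].
  have -> : (a u * a v)%R = 0%R.
    by rewrite /a (negbTE ux) (negbTE vx) /= -natrM mulnb yy.
  by rewrite add0r fe.
- by rewrite -add1n; apply: rank_fun_mx_add fr; apply: rank_outer_product.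
Qed.

(* The sets N(x) and N[x] realize the star of x: a pair of neighbours of x lies
   in both, a pair of x and a neighbour only in N[x]. *)
Lemma representable_star e e' x k : symmetric e -> irreflexive e ->
  (forall u v, e' u v = [&& u != x, v != x & e u v]) ->
  representable e' k -> representable e k.+2.
Proof.
move=> esym eirr e'E [[C Cp <-] HK]; split.
  pose N := [set v | e x v].
  exists (N :: (x |: N) :: C) => // u v uv.
  rewrite /= !oddD !oddb -Cp // e'E !inE.
  case: (eqVneq u x) => [ux|ux]; case: (eqVneq v x) => [vx|vx] /=.
  - by rewrite ux vx eqxx in uv.
  - by rewrite ux eirr addbF.
  - by rewrite vx eirr andbF andbT addbF esym.
  - by rewrite addbA addbb.
move=> K; have [f [fsym fe fr]] := HK K.
(* Over a general field the star is the outer product of the indicators of [x] and of its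
   neighbourhood, plus the transpose. *)
exists (fun u v => (u == x)%:R * (e x v)%:R + ((e x u)%:R * (v == x)%:R + f u v))%R.
split.
- move=> u v; rewrite !addrA fsym; congr (_ + _)%R.
  by rewrite addrC; congr (_ + _)%R; rewrite mulrC.
- move=> u v uv; have := fe u v uv; rewrite e'E.
  case: (eqVneq u x) => [ux|ux]; case: (eqVneq v x) => [vx|vx] /=.
  + by rewrite ux vx eqxx in uv.
  + move/negbFE/eqP->; rewrite mul1r mulr0 !addr0 ux.
    by case: (e x v); rewrite ?oner_eq0 ?eqxx.
  + move/negbFE/eqP->; rewrite mul0r mulr1 add0r addr0 vx esym.
    by case: (e u x); rewrite ?oner_eq0 ?eqxx.
  + by rewrite mul0r mulr0 !add0r.
- rewrite -(add1n (size C).+1) -(add1n (size C)).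
  apply: rank_fun_mx_add; first exact: rank_outer_product.
  by apply: rank_fun_mx_add fr; exact: rank_outer_product.
Qed.

End Representable.

(** * Chords and longest paths in a forest *)

Section Forest.
Variable F : sgraph.
Hypothesis forestF : forest F.
Local Notation e := (@adj F).

(** An edge from [x] to a vertex beyond the second one would close an initial segment of the path
    into a cycle of length at least 3. *)
Lemma forest_chord x p y :
  path e x p -> uniq (x :: p) -> y \in p -> e x y -> y = head x p.
Proof.
case: p => // z p xp up; rewrite inE => /orP[/eqP//|yp] exy.
case/splitPr: yp xp up => p1 p2.
rewrite -cat_rcons -cat_cons -[_ :: _ ++ _]cat_cons cat_path cat_uniq.
case/andP=> xp _ /andP[up _].
case: (@forestF (x :: z :: rcons p1 y)); first by rewrite /= size_rcons.
rewrite /ucycle up andbT /cycle rcons_path xp /=.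
by rewrite last_rcons adj_sym.
Qed.

(** By [forest_chord] each vertex has only its successor as a later neighbour. This is why path
    lists below only record adjacency of consecutive vertices. *)
Lemma sorted_induces_path s : sorted e s -> uniq s ->
  {in s &, forall u v, e u v = (index v s == (index u s).+1)
                           || (index u s == (index v s).+1)}.
Proof.
elim: s => // x s IHs /= xs /andP[xs' us].
have head_adj v : v \in s -> e x v = (index v s == 0).
  case: s xs xs' us {IHs} => // z s /= /andP[exz zs] xs' us vs.
  case: (eqVneq z v) => [<-|zv]; first by rewrite exz.
  apply/negbTE/negP => /(@forest_chord x (z :: s)) /= vz.
  by move: zv; rewrite vz ?eqxx // ?exz ?zs ?inE ?vs ?orbT // xs'.
move=> u v; rewrite !inE; case: (eqVneq u x) => [->|ux] /=.
  case: (eqVneq v x) => [->|vx] /= => [_ _|_ vs]; first by rewrite adj_irrefl.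
  by rewrite head_adj // eqSS orbF.
move=> us'; case: (eqVneq v x) => [->|vx] /= => [_|vs].
  by rewrite adj_sym head_adj // eqSS.
by rewrite !eqSS IHs ?(path_sorted xs).
Qed.

(* x is the end of a longest path inside U. *)
Lemma forest_end (U : {set F}) : U != set0 ->
  exists2 x, x \in U &
    (forall v, v \in U -> ~~ e x v) \/
    exists y, [/\ y \in U, forall v, v \in U -> e x v = (v == y) &
      (exists z, [/\ z \in U, z != x & forall v, v \in U -> e z v = (v == y)])
      \/ (exists z, forall v, v \in U -> e y v -> v = x \/ v = z)].
Proof.
case/set0Pn=> x0 x0U.
pose valid (s : seq F) := [&& sorted e s, uniq s & all (mem U) s].
pose P n := [exists t : n.-tuple F, valid t].
have exP : exists n, P n by exists 0; apply/existsP; exists [tuple].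
have leP n : P n -> n <= #|F|.
  case/existsP=> t /and3P[_ ut _].
  by rewrite -(size_tuple t) -(card_uniqP ut) max_card.
have [n /existsP[t vt] maxn] := ex_maxnP exP leP.
have maxt s : valid s -> size s <= n.
  by move=> vs; apply: maxn; apply/existsP; exists (in_tuple s).
(* A neighbour off the path would prolong it; one on the path is the second vertex. *)
have end_leaf x p : valid (x :: p) -> n <= (size p).+1 ->
    forall v, v \in U -> e x v -> v = head x p.
  move=> xp np v vU exv; case/and3P: (xp) => /= sp up aU.
  case vp: (v \in p); first exact: forest_chord vp exv.
  have : valid (v :: x :: p).
    rewrite /valid /= adj_sym exv sp /= inE vp orbF vU /=.
    rewrite up aU !andbT.
    by apply: contraTneq exv => ->; rewrite adj_irrefl.
  by move/maxt; rewrite ltnNge np.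
case: {maxn}t vt => -[|x p] /= /eqP nE vt.
  have : valid [:: x0] by rewrite /valid /= x0U.
  by move/maxt; rewrite -nE.
have xU : x \in U by case/and3P: vt => _ _ /= /andP[].
exists x => //.
case: p nE vt => [|y p] nE vt.
  left=> v vU; apply/negP => exv.
  have vx : v = x by apply: end_leaf vt _ v vU exv; rewrite nE.
  by rewrite vx adj_irrefl in exv.
case/and3P: (vt) => /= /andP[exy yp] /and3P[xyp yp' up] /and3P[_ yU pU].
right; exists y; split=> // [v vU|].
  apply/idP/eqP => [|-> //].
  by apply: end_leaf vt _ v vU; rewrite -nE.
(* A neighbour [z] of [y] other than [x] and the third vertex lies off the path and can replace [x],
   so it is a leaf too. For empty [p] the default of [head] is [y], which is no neighbour of
   itself. *)
case: (pickP [pred z | [&& z \in U, e y z, z != x & z != head y p]]).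
  move=> z /= /and4P[zU eyz zx zh]; left; exists z; split=> //.
  have zp : z \notin p.
    apply: contra zh => zp; apply/eqP.
    by apply: forest_chord eyz; rewrite //= yp'.
  have zv : valid (z :: y :: p).
    rewrite /valid /= adj_sym eyz yp yp' up zU yU pU inE (negbTE zp) orbF !andbT /=.
    by apply: contraTneq eyz => ->; rewrite adj_irrefl.
  move=> v vU; apply/idP/eqP => [|->]; last by rewrite adj_sym.
  by apply: end_leaf zv _ v vU; rewrite -nE.
move=> none; right; exists (head y p) => v vU eyv.
move: (none v); rewrite /= vU eyv /=.
by case: eqVneq => [->|_ /negbFE/eqP->]; [left | right].
Qed.

(** * Induced subforests, path lists and the upper bound *)

Definition restrict (U : {set F}) : rel F :=
  fun u v => [&& u \in U, v \in U & e u v].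

Lemma restrictD1 (U : {set F}) x u v :
  restrict (U :\ x) u v = [&& u != x, v != x & restrict U u v].
Proof.
by rewrite /restrict !inE; case: (u == x); case: (v == x); rewrite ?andbF.
Qed.

Lemma restrict_sym (U : {set F}) : symmetric (restrict U).
Proof. by move=> u v; rewrite /restrict adj_sym andbCA. Qed.

Lemma restrict_irrefl (U : {set F}) : irreflexive (restrict U).
Proof. by move=> u; rewrite /restrict adj_irrefl !andbF. Qed.

Lemma restrict_leaf (U : {set F}) x y : x \in U -> y \in U ->
  (forall v, v \in U -> e x v = (v == y)) ->
  forall v, restrict U x v = (v == y).
Proof.
move=> xU yU ex v; rewrite /restrict xU /=.
case: (boolP (v \in U)) => [/ex //|vU] /=.
by apply/esym; apply: contraNF vU => /eqP->.
Qed.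

(** The permutation condition expresses disjointness and covering at once; sequences keep the order,
    so that ends can be extended. *)
Definition path_list (U : {set F}) (P : seq (seq F)) :=
  perm_eq (flatten P) (enum U) && all (fun s => (s != [::]) && sorted e s) P.

Lemma perm_enumD1 (U : {set F}) x :
  x \in U -> perm_eq (enum U) (x :: enum (U :\ x)).
Proof.
move=> xU; apply: uniq_perm; rewrite /= ?mem_enum ?enum_uniq ?inE ?eqxx //.
move=> v; rewrite inE !mem_enum !inE.
by case: eqVneq => // ->; rewrite xU.
Qed.

(** Without [x], the vertex [y] has [z] as its only possible neighbour, so [y] is an end of its path
    and [x] can be attached there. *)
Lemma path_list_extend (U : {set F}) x y z P : x \in U -> y \in U :\ x ->
  e x y -> (forall v, v \in U -> e y v -> v = x \/ v = z) ->
  path_list (U :\ x) P -> exists2 Q, path_list U Q & size Q = size P.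
Proof.
move=> xU yU exy nbr_y /andP[permP pathP].
have /flattenP[s sP ys] : y \in flatten P by rewrite (perm_mem permP) mem_enum.
have permPs := perm_to_rem sP.
have szP : size P = (size (rem s P)).+1 by rewrite (perm_size permPs).
move: pathP; rewrite (perm_all _ permPs) /= => /andP[/andP[s0 ss] pathR].
have flat t : perm_eq t (x :: s) -> perm_eq (flatten (t :: rem s P)) (enum U).
  move=> ts; apply: perm_trans (_ : perm_eq (x :: flatten P) _).
    apply: perm_trans (_ : perm_eq _ (x :: flatten (s :: rem s P))) _; last first.
      by rewrite perm_cons perm_flatten // perm_sym.
    by rewrite /= -cat_cons perm_cat2r.
  by rewrite perm_sym (permPl (perm_enumD1 xU)) perm_cons perm_sym.
have sU v : v \in s -> v \in U :\ x.
  by move=> vs; rewrite -mem_enum -(perm_mem permP); apply/flattenP; exists s.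
have us : uniq s.
  have : uniq (flatten (s :: rem s P)).
    by rewrite -(perm_uniq (perm_flatten permPs)) (perm_uniq permP) enum_uniq.
  by rewrite /= cat_uniq => /andP[].
suff [t ts tp] : exists2 t, perm_eq t (x :: s) & sorted e t.
  exists (t :: rem s P); last by [].
  rewrite /path_list flat //= tp pathR andbT andbT.
  by rewrite -size_eq0 (perm_size ts).
case/splitPr: s / ys sP permPs szP s0 ss pathR flat sU us => s1 s2.
move=> _ _ _ _ ss _ _ sU us.
case: (lastP s1) ss sU us => [|s1' a] ss sU us.
  by exists (x :: y :: s2); rewrite //= exy.
case: s2 ss sU us => [|b s2] ss sU us.
  exists (rcons (rcons s1' a ++ [:: y]) x); first by rewrite perm_rcons.
  rewrite cats1 in ss *; case: (rcons s1' a) ss => /= [_|c r].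
    by rewrite adj_sym exy.
  by move=> ss; rewrite rcons_path ss last_rcons adj_sym.
(* If [y] were interior, its two neighbours [a] and [b] on the path would both equal [z], and the
   path would repeat a vertex. *)
have ss' : e a y && e y b.
  move: ss; rewrite cat_rcons; case: s1' {sU us} => /= [|c r].
    by case/and3P=> -> ->.
  by rewrite cat_path /= => /and4P[_ _ -> /andP[->]].
case/andP: ss' => eay eyb.
have az : a = z.
  have := sU a; rewrite mem_cat mem_rcons mem_head !inE => /(_ isT)/andP[ax aU].
  by case: (nbr_y a); rewrite // 1?adj_sym // => /eqP; rewrite (negbTE ax).
have bz : b = z.
  have := sU b; rewrite mem_cat !inE eqxx !orbT => /(_ isT)/andP[bx bU].
  by case: (nbr_y b); rewrite // => /eqP; rewrite (negbTE bx).
by move: us; rewrite az bz cat_uniq /= !mem_rcons !inE eqxx !orbT andbF.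
Qed.

Lemma forest_path_list (U : {set F}) : exists k P,
  [/\ path_list U P, k + size P <= #|U| & representable (restrict U) k].
Proof.
have [n] := ubnP #|U|; elim: n U => // n IHn U leU.
have [->|U0] := eqVneq U set0.
  exists 0, [::]; split=> //; first by rewrite /path_list enum_set0.
  by apply: representable0 => u v _; rewrite /restrict inE.
have [x xU] := forest_end U0.
have [] : #|U :\ x| < n by move: leU; rewrite (cardsD1 x) xU.
(* This instance for [U :\ x] serves the isolated and the appending case; the case of two leaves
   removes three vertices instead. *)
move/IHn => [k [P [PU kP rk]]] [xiso|[y [yU xleaf]]].
  exists k, ([:: x] :: P); split.
  - case/andP: PU => PU PA; rewrite /path_list /= PA andbT.
    by rewrite perm_sym (permPl (perm_enumD1 xU)) perm_cons perm_sym.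
  - by rewrite (cardsD1 x) xU /=; lia.
  - have iso v : restrict U x v = false.
      by apply/negP => /and3P[_ /xiso/negP].
    have E u v : restrict (U :\ x) u v = restrict U u v.
      rewrite restrictD1; case: eqVneq => [->|_]; first by rewrite iso.
      by case: eqVneq => [->|_] //; rewrite restrict_sym iso.
    by rewrite (_ : restrict U = restrict (U :\ x)) //;
      apply: boolp.funext => u; apply: boolp.funext => v.
have rleaf := restrict_leaf xU yU xleaf.
have exy : e x y by rewrite xleaf ?eqxx.
have xy : x != y by apply: contraTneq exy => ->; rewrite adj_irrefl.
case=> [[z [zU zx zleaf]]|[z nbr_y]].
  have rzleaf := restrict_leaf zU yU zleaf.
  have eyz : e y z by rewrite adj_sym zleaf ?eqxx.
  have yz : y != z by apply: contraTneq eyz => ->; rewrite adj_irrefl.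
  pose U1 := U :\ y; pose U2 := U1 :\ x; pose U3 := U2 :\ z.
  have xU1 : x \in U1 by rewrite !inE xy.
  have zU2 : z \in U2 by rewrite !inE zx eq_sym yz.
  have cU : #|U| = #|U3|.+3.
    by rewrite (cardsD1 y) yU (cardsD1 x) xU1 (cardsD1 z) zU2.
  have [|k3 [P3 [PU3 kP3 rk3]]] := IHn U3; first by lia.
  exists k3.+2, ([:: x; y; z] :: P3); split.
  - case/andP: PU3 => PU3 PA3; rewrite /path_list /= PA3 exy eyz !andbT.
    rewrite perm_sym (permPl (perm_enumD1 yU)).
    rewrite perm_sym -[X in perm_eq X _]/([:: x] ++ [:: y] ++ _) perm_catCA /=.
    rewrite perm_cons perm_sym.
    rewrite (permPl (perm_enumD1 xU1)) perm_cons.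
    by rewrite (permPl (perm_enumD1 zU2)) perm_cons perm_sym.
  - by rewrite cU /=; lia.
  - apply: (representable_star (e' := restrict U3) (x := y)) => //.
    + exact: restrict_sym.
    + exact: restrict_irrefl.
    (* Deleting [y] already isolates its leaves [x] and [z], so removing them as well deletes no
       further edge. *)
    move=> u v; rewrite /U3 /U2 /U1 !restrictD1.
    case: (eqVneq u y) => //= uy; rewrite ?andbF //.
    case: (eqVneq v y) => //= vy; rewrite ?andbF //.
    case: (eqVneq u x) => [->|_]; first by rewrite rleaf (negbTE vy) !andbF.
    case: (eqVneq u z) => [->|_]; first by rewrite rzleaf (negbTE vy) !andbF.
    case: (eqVneq v x) => [->|_].
      by rewrite restrict_sym rleaf (negbTE uy) !andbF.
    case: (eqVneq v z) => [->|_] //.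
    by rewrite restrict_sym rzleaf (negbTE uy).
have yU' : y \in U :\ x by rewrite !inE eq_sym xy.
have [Q QU sQ] := path_list_extend xU yU' exy nbr_y PU.
exists k.+1, Q; split=> //.
- by rewrite sQ (cardsD1 x) xU; lia.
- apply: (representable_leaf (x := x) (y := y)) rk => //.
  + exact: restrict_sym.
  + exact: restrictD1.
Qed.

Lemma path_list_cover P : path_list [set: F] P ->
  exists2 Q, @path_cover F Q & #|Q| <= size P.
Proof.
case/andP=> permP /allP pathP.
have uP : uniq (flatten P) by rewrite (perm_uniq permP) enum_uniq.
pose Q := [set A in [seq [set v in s] | s <- P]].
exists Q; last first.
  by rewrite cardsE (leq_trans (card_size _)) // size_map.
have inQ A : reflect (exists2 s, s \in P & A = [set v in s]) (A \in Q).
  by rewrite inE; apply: mapP.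
split.
  apply/and3P; split.
  - apply/eqP/setP => v; rewrite inE.
    have /flattenP[s sP vs] : v \in flatten P.
      by rewrite (perm_mem permP) mem_enum inE.
    by apply/bigcupP; exists [set w in s]; rewrite ?inE //; apply/mapP; exists s.
  - apply/trivIsetP => _ _ /inQ[s sP ->] /inQ[t tP ->].
    apply: contraR => /pred0Pn[v /andP[]]; rewrite !inE => vs vt.
    apply/eqP; congr [set w in _].
    case: (eqVneq t s) => [-> //|ts].
    move: uP; rewrite (perm_uniq (perm_flatten (perm_to_rem sP))) /= cat_uniq.
    case/and3P=> _ /negP[]; apply/hasP; exists v => //.
    apply/flattenP; exists t => //.
    by move: tP; rewrite (perm_mem (perm_to_rem sP)) inE (negbTE ts).
  - apply/inQ => -[s /pathP/andP[s0 _]].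
    by case: s s0 => // v s _ /setP/(_ v); rewrite !inE eqxx.
move=> _ /inQ[s sP ->]; exists s.
have /andP[s0 ss] := pathP s sP.
have us : uniq s.
  move: uP; rewrite (perm_uniq (perm_flatten (perm_to_rem sP))) /= cat_uniq.
  by case/andP.
by split=> // [v|]; [rewrite inE | exact: sorted_induces_path].
Qed.

(** * Rank bounds the number of edges of a subgraph of maximum degree 2 *)

Section LowerBound.
Variables (K : fieldType) (l : rel F).
Hypotheses (l_sym : symmetric l) (l_adj : forall u v, l u v -> e u v).
Hypothesis l_deg : forall u, \sum_v l u v <= 2.

Lemma sum_degreeD1 (U : {set F}) x : x \in U ->
  \sum_(u in U) \sum_(v in U) l u v =
  \sum_(u in U :\ x) \sum_(v in U :\ x) l u v + (\sum_(v in U :\ x) l x v).*2.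
Proof.
move=> xU; rewrite (big_setD1 x) //= (big_setD1 x) //=.
have -> : l x x = false by apply/negP => /l_adj; rewrite adj_irrefl.
rewrite add0n -addnn addnA [RHS]addnC; congr (_ + _).
rewrite -big_split /=; apply: eq_bigr => u _.
by rewrite (big_setD1 x) //= l_sym addnC.
Qed.

(** With the diagonal zero outside [U], all rows and columns outside [U] vanish, so the rank is that
    of the block on [U]. *)
Definition fits_on (U : {set F}) (f : F -> F -> K) :=
  (forall u v, u != v -> (f u v != 0%R) = restrict U u v) /\
  (forall u, u \notin U -> f u u = 0%R).

Lemma fits_on_eq0 (U : {set F}) f u v :
  fits_on U f -> u \notin U -> f u v = 0%R /\ f v u = 0%R.
Proof.
move=> [fU f0] uU; case: (eqVneq u v) => [<-|uv]; first by rewrite f0.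
split; apply/eqP; rewrite -[_ == _]negbK fU ?(eq_sym v) //.
  by rewrite /restrict (negbTE uU).
by rewrite /restrict (negbTE uU) andbF.
Qed.

(** The rank is doubled because the double sum counts every edge of [l] twice. The induction
    generalizes [f], which the pivots alter. *)
Lemma rank_ge_degree (U : {set F}) f : fits_on U f ->
  \sum_(u in U) \sum_(v in U) l u v <= (\rank (fun_mx f)).*2.
Proof.
have [n] := ubnP #|U|; elim: n U f => // n IHn U f leU fU.
have [->|U0] := eqVneq U set0; first by rewrite big_set0.
have [x xU xend] := forest_end U0.
have ltD1 z (W : {set F}) : z \in W -> #|W| < n.+1 -> #|W :\ z| < n.
  by move=> zW; rewrite (cardsD1 z W) zW.
have f0 u v : u != v -> ~~ restrict U u v -> f u v = 0%R.
  by move=> uv; rewrite -fU.1 // negbK => /eqP.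
have uniq_nbr u v : restrict U x u -> restrict U x v -> u = v.
  case: xend => [xiso /and3P[_ /xiso/negP//]|[y [yU xleaf _]]].
  by rewrite !(restrict_leaf xU yU xleaf) => /eqP-> /eqP->.
have deg_x : \sum_(v in U :\ x) l x v <= 1.
  have l0 v : v \in U -> ~~ restrict U x v -> l x v = false.
    by move=> vU; apply: contraNF => /l_adj; rewrite /restrict xU vU.
  case: (pickP [pred v in U :\ x | restrict U x v]) => [y /andP[yU xy]|no].
    rewrite (big_setD1 y) //= big1 ?addn0 ?leq_b1 // => v.
    rewrite !inE => /and3P[vy _ vU]; rewrite l0 //.
    by apply: contra vy => xv; rewrite (uniq_nbr v y).
  rewrite big1 // => v vU; have := no v; rewrite /= vU /= => /negbT nv.
  by rewrite l0 //; move: vU; rewrite inE => /andP[].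
have [fxx|fxx] := eqVneq (f x x) 0%R; last first.
  have := rank_pivot fxx; set g := fun u v => _ => rk.
  have gU : fits_on (U :\ x) g.
    split=> [u v uv|u]; rewrite /g.
      rewrite restrictD1; case: (eqVneq u x) => [->|ux].
        by rewrite divff // mul1r subrr eqxx.
      case: (eqVneq v x) => [->|vx] /=; first by rewrite divfK // subrr eqxx.
      (* As [x] has at most one neighbour, outside row and column [x] the pivot can change only the
         diagonal entry at that neighbour. *)
      have -> : (f u x / f x x * f x v = 0)%R.
        case: (boolP (restrict U u x)) => [ux'|/f0->]; rewrite ?mul0r //.
        case: (boolP (restrict U x v)) => [xv'|/f0->]; rewrite ?mulr0 1?eq_sym //.
        by rewrite restrict_sym in ux'; rewrite (uniq_nbr u v) // eqxx in uv.
      by rewrite subr0 fU.1.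
    rewrite !inE negb_and negbK => /orP[/eqP->|uU].
      by rewrite divff // mul1r subrr.
    have [-> _] := fits_on_eq0 u fU uU; have [-> _] := fits_on_eq0 x fU uU.
    by rewrite !mul0r subrr.
  have := IHn _ _ (ltD1 _ _ xU leU) gU.
  by rewrite (sum_degreeD1 xU); lia.
case: xend => [xiso|[y [yU xleaf _]]].
  (* Row and column [x] are already zero, so [x] is dropped without a pivot. *)
  have iso v : restrict U x v = false.
    by apply/negP => /and3P[_ /xiso/negP].
  have fU' : fits_on (U :\ x) f.
    split=> [u v uv|u].
      rewrite fU.1 // restrictD1; case: (eqVneq u x) => [->|_].
        by rewrite iso.
      by case: (eqVneq v x) => [->|_] //; rewrite restrict_sym iso.
    by rewrite !inE negb_and negbK => /orP[/eqP->|/fU.2].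
  have := IHn _ _ (ltD1 _ _ xU leU) fU'.
  rewrite (sum_degreeD1 xU) [X in _ + X.*2]big1 ?addn0 // => v.
  rewrite inE => /andP[_ vU]; apply/eqP; rewrite eqb0.
  by apply: contra (xiso v vU); apply: l_adj.
have rleaf := restrict_leaf xU yU xleaf.
have xy : x != y.
  have : e x y by rewrite xleaf ?eqxx.
  by apply: contraTneq => ->; rewrite adj_irrefl.
have fyx : f y x != 0%R by rewrite fU.1 1?eq_sym // restrict_sym rleaf.
have fx v : v != y -> f x v = 0%R /\ f v x = 0%R.
  move=> vy; case: (eqVneq v x) => [->//|vx].
  by split; apply: f0; rewrite // 1?eq_sym // 1?[restrict U v x]restrict_sym rleaf.
(* Column [x] is supported at [y], so this pivot only clears row [y]; likewise the next one only
   clears column [y]. Then [x] has a zero row and column. *)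
have := rank_pivot fyx; set g := fun u v => _ => rk1.
have gE u v : g u v = if u == y then 0%R else f u v.
  rewrite /g; case: eqVneq => [->|uy]; first by rewrite divff // mul1r subrr.
  by have [_ ->] := fx u uy; rewrite !mul0r subr0.
have gxy : g x y != 0%R by rewrite gE (negbTE xy) fU.1 // rleaf.
have := rank_pivot gxy; set h := fun u v => _ => rk2.
have hE u v : h u v = if (u == y) || (v == y) then 0%R else f u v.
  rewrite /h; case: (eqVneq v y) => [->|vy].
    by rewrite divfK // subrr orbT.
  rewrite !gE (negbTE xy); have [-> _] := fx v vy.
  by rewrite mulr0 subr0 orbF.
have hU : fits_on (U :\ y :\ x) h.
  split=> [u v uv|u]; rewrite hE.
    rewrite !restrictD1.
    case: (eqVneq u y) => //= uy; rewrite ?eqxx ?andbF //.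
    case: (eqVneq v y) => //= vy; rewrite ?eqxx ?andbF //.
    case: (eqVneq u x) => [->|ux] /=; first by have [-> _] := fx v vy; rewrite eqxx.
    case: (eqVneq v x) => [->|vx] /=; first by have [_ ->] := fx u uy; rewrite eqxx.
    exact: fU.1.
  rewrite orbb !inE !negb_and !negbK.
  by case: (eqVneq u y) => //= uy /orP[/eqP->|/fU.2].
have xU1 : x \in U :\ y by rewrite !inE xy.
have := IHn _ _ (ltD1 _ _ xU1 (ltnW (ltD1 _ _ yU leU))) hU.
have deg_y : \sum_(v in U :\ y) l y v <= 2.
  apply: leq_trans (l_deg y); rewrite [X in _ <= X](bigID (mem (U :\ y))) /=.
  exact: leq_addr.
(* Removing [y] first counts the edge [xy] among the at most two at [y], and [x] then contributes
   nothing. *)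
rewrite (sum_degreeD1 yU) (sum_degreeD1 xU1).
rewrite [X in _ + X.*2 + _]big1; first by lia.
move=> v; rewrite !inE => /and3P[_ vy vU]; apply/eqP; rewrite eqb0.
by apply/negP => /l_adj; rewrite xleaf // (negbTE vy).
Qed.

End LowerBound.

(** * Degrees in a path cover *)

Lemma sum_index_eq (s : seq F) k :
  uniq s -> \sum_(v <- s) (index v s == k) = (k < size s).
Proof.
elim: s k => [|x s IHs] k /=; first by rewrite big_nil.
case/andP=> xs us; rewrite big_cons /= eqxx.
have E : \sum_(v <- s) ((if x == v then 0 else (index v s).+1) == k) =
         \sum_(v <- s) ((index v s).+1 == k).
  apply: eq_big_seq => v vs; case: (eqVneq x v) => // xv.
  by rewrite xv vs in xs.
rewrite E; case: k {E} => [|k]; first by rewrite big1.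
exact: IHs.
Qed.

Lemma path_degree (A : {set F}) (s : seq F) u : uniq s -> A =i s -> u \in s ->
  {in s &, forall u v, e u v = (index v s == (index u s).+1)
                           || (index u s == (index v s).+1)} ->
  \sum_(v in A) e u v = ((index u s).+1 < size s) + (0 < index u s).
Proof.
move=> us As u_s adjE.
rewrite (eq_bigl _ _ As) -big_uniq //=.
rewrite (eq_big_seq (fun v => (index v s == (index u s).+1)
                            + (index u s == (index v s).+1))); last first.
  move=> v vs; rewrite adjE //; lia.
rewrite big_split /= sum_index_eq //; congr addn.
case iu: (index u s) => [|k]; first by rewrite big1.
under eq_bigr => v _ do rewrite eqSS eq_sym.
by rewrite sum_index_eq //; move: u_s; rewrite -index_mem iu => /ltnW ->.
Qed.

(** Let [l] consist of the edges inside blocks of [P]. A path on [s] vertices has degree sum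
    [2s - 2], so the total is twice [#|F| - #|P|]. *)
Lemma path_cover_rank (K : fieldType) (f : F -> F -> K) P :
  (forall u v, u != v -> (f u v != 0%R) = e u v) -> @path_cover F P ->
  #|F| <= \rank (fun_mx f) + #|P|.
Proof.
move=> fe [partP pathP]; case/and3P: (partP) => /eqP coverP tiP _.
pose l u v := e u v && (pblock P u == pblock P v).
have inP u : u \in cover P by rewrite coverP inE.
have sum_l A u : A \in P -> u \in A -> \sum_v l u v = \sum_(v in A) e u v.
  move=> AP uA; rewrite [RHS]big_mkcond; apply: eq_bigr => v _.
  rewrite /l eq_pblock // (def_pblock tiP AP uA).
  by case: (v \in A); rewrite ?andbT ?andbF.
have l_deg u : \sum_v l u v <= 2.
  rewrite (sum_l (pblock P u)) ?pblock_mem ?mem_pblock //.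
  have [s [_ us As adjE]] := pathP _ (pblock_mem (inP u)).
  rewrite (path_degree us As) -?As ?mem_pblock //.
  by case: (_ < _); case: (_ < _).
have l_sym : symmetric l by move=> u v; rewrite /l adj_sym eq_sym.
have l_adj u v : l u v -> e u v by case/andP.
have fF : fits_on [set: F] f.
  by split=> [u v /fe->|u]; rewrite /restrict !inE.
have := rank_ge_degree l_sym l_adj l_deg fF.
rewrite (eq_bigr (fun u => \sum_v l u v)); last first.
  by move=> u _; apply: eq_bigl => v; rewrite inE.
suff : #|F|.*2 <= \sum_(u in [set: F]) \sum_v l u v + #|P|.*2 by lia.
rewrite -cardsT -muln2 -sum_nat_const !(set_partition_big _ partP) /=.
rewrite -[#|P|.*2]muln2 -sum_nat_const -big_split /=.
apply: leq_sum => A AP; have [s [s0 us As adjE]] := pathP A AP.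
rewrite [X in _ <= X + _](eq_bigr (fun u =>
  ((index u s).+1 < size s) + (0 < index u s))); last first.
  by move=> u uA; rewrite (sum_l A) // (path_degree us As) -?As.
rewrite !(eq_bigl _ _ As) -!big_uniq //=.
have s_gt0 : 0 < size s by rewrite lt0n size_eq0.
(* The missing 2 is charged to the last and the first vertex, which makes the inequality termwise;
   on a one-vertex path both charges fall on that vertex. *)
have two : 2 = \sum_(u <- s) (index u s == (size s).-1)
              + \sum_(u <- s) (index u s == 0).
  by rewrite !sum_index_eq // s_gt0 ltn_predL s_gt0.
rewrite [X in _ <= _ + X]two -!big_split /= !big_seq; apply: leq_sum => u.
by move=> u_s; have : index u s < size s; [rewrite index_mem | lia].
Qed.

End Forest.

(** * Complementation systems over GF(2) and the conclusion *)

Lemma complementation_system_rank (G : sgraph) (C : seq {set G}) :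
  @complementation_system G C -> exists f : G -> G -> 'F_2,
    (forall u v, u != v -> (f u v != 0%R) = adj u v) /\
    \rank (fun_mx f) <= size C.
Proof.
move=> CG.
(* Modulo 2 this is a sum over [C] of outer squares of indicator vectors, one rank-1 term per
   set. *)
exists (fun u v => (count (fun S : {set G} => (u \in S) && (v \in S)) C)%:R%R).
split=> [u v uv|].
  by rewrite CG // -(dvdn_pcharf (pchar_Fp (isT : prime 2))) dvdn2 negbK.
elim: C {CG} => [|S C IHC] /=.
  have -> : fun_mx (fun _ _ : G => 0%:R%R : 'F_2) = 0%R.
    by apply/matrixP => i j; rewrite !mxE.
  by rewrite mxrank0.
have -> : fun_mx (fun u v : G => (((u \in S) && (v \in S)) +
    count (fun S0 : {set G} => (u \in S0) && (v \in S0)) C)%:R%R : 'F_2) =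
  fun_mx (fun u v : G => ((u \in S)%:R * (v \in S)%:R +
    (count (fun S0 : {set G} => (u \in S0) && (v \in S0)) C)%:R)%R : 'F_2).
  by apply/matrixP => i j; rewrite !mxE natrD -natrM mulnb.
rewrite -(add1n (size C)); apply: rank_fun_mx_add IHC; exact: rank_outer_product.
Qed.

Theorem theorem4p16 (F : sgraph) (K : fieldType) (forestF : forest F) :
  complementation_number F = minimum_rank F K /\
  minimum_rank F K = #|F| - path_cover_number F.
Proof.
have [[P Pcover cardP] min_p] := minimumP (path_cover_exists F).
have [[C CF sizeC] min_c] := minimumP (complementation_system_exists F).
have [[A [_ Afits] rankA] min_r] := minimumP (fits_exists F K).
rewrite -/(path_cover_number F) -/(complementation_number F)
  -/(minimum_rank F K) in cardP min_p sizeC min_c rankA min_r *.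
have p_le := path_cover_number_le F.
have r_ge : #|F| <= minimum_rank F K + path_cover_number F.
  have := path_cover_rank forestF (f := fun u v => A (enum_rank u) (enum_rank v))
    Afits Pcover.
  rewrite cardP (_ : fun_mx _ = A) ?rankA //.
  by apply/matrixP => i j; rewrite mxE !enum_valK.
(* Here the rank bound is applied over GF(2), whatever [K] is. *)
have c_ge : #|F| <= complementation_number F + path_cover_number F.
  have [f [fe fr]] := complementation_system_rank CF.
  by have := path_cover_rank forestF fe Pcover; rewrite cardP; lia.
have [k [Ps [PsF kPs [[C' C'F sizeC'] HK]]]] := forest_path_list forestF [set: F].
have [Q Qcover cardQ] := path_list_cover forestF PsF.
have p_leQ : path_cover_number F <= #|Q| by apply: min_p; exists Q.
have c_le : complementation_number F <= k.
  apply: min_c; exists C' => // u v uv.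
  by rewrite -C'F // /restrict !inE.
have r_le : minimum_rank F K <= k.
  have [f [fsym fe fr]] := HK K.
  apply: leq_trans fr; apply: min_r; exists (fun_mx f) => //; split.
    by apply/matrixP => i j; rewrite !mxE.
  by move=> u v uv; rewrite mxE !enum_rankK fe // /restrict !inE.
have sum_le : k + path_cover_number F <= #|F|.
  rewrite -(cardsT F); apply: leq_trans kPs.
  by rewrite leq_add2l (leq_trans p_leQ).
(* Both invariants are at most [k], at most [#|F|] minus the path cover number, which bounds both
   from below. *)
by split; lia.
Qed.
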